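(* Let $P$ be an irreducible stochastic matrix over a finite set $\Omega$ which is not a cycle, let $\ell\ge 1$ be an integer, and let $T=[T_{pq}]\in M_\ell(\mathcal T_+(P))$. Then $$\|T\|=\max\{\ \|[T_{pq}|_{\mathcal H_{P,k}}]\|\ :\ k\in\Omega \text{ is escorted}\ \}.$$
   Context: A stochastic matrix over a finite set $\Omega$ is a function $P:\Omega\times\Omega\to[0,1]$ with $\sum_{j\in\Omega}P_{ij}=1$ for all $i\in\Omega$; elements of $\Omega$ are called states. Write $P_{ij}^{(n)}=(P^n)_{ij}$ for integers $n\ge 0$, with $P^{(0)}=I$. $\mathrm{Gr}(P)$ is the directed graph on $\Omega$ with a directed edge $(i,j)$ exactly when $P_{ij}>0$, and $(i,j)\in\mathrm{Gr}(P^n)$ means $P^{(n)}_{ij}>0$. $P$ is irreducible if $\mathrm{Gr}(P)$ is strongly connected. A finite irreducible stochastic matrix $P$ is a cycle if $\mathrm{Gr}(P)$ is a simple cycle as a directed graph (a single vertex with a loop counts as a cycle). Tensor algebra: for $k\in\Omega$ let $\mathcal H_{P,k}$ be the Hilbert space with orthonormal basis $\{\xi_{m,j,k}: m\ge 0,\ j\in\Omega,\ (j,k)\in\mathrm{Gr}(P^m)\}$, and let $\mathcal H_P=\bigoplus_{k\in\Omega}\mathcal H_{P,k}$. For $n\ge0$ and $(i,j)\in\mathrm{Gr}(P^n)$ let $S_{ij}^{(n)}\in B(\mathcal H_P)$ be the bounded operator given by $$S_{ij}^{(n)}(\xi_{m,j',k})=\begin{cases}\sqrt{\frac{P_{ij}^{(n)}P_{jk}^{(m)}}{P_{ik}^{(n+m)}}}\;\xi_{n+m,i,k}&\text{if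 }j=j',\\ 0&\text{otherwise.}\end{cases}$$ Then $\mathcal T_+(P)\subseteq B(\mathcal H_P)$ is the norm-closed algebra (not necessarily self-adjoint) generated by $\{S_{ij}^{(n)}:(i,j)\in\mathrm{Gr}(P^n),\ n\ge0\}$. Each $\mathcal H_{P,k}$ is a reducing subspace for $\mathcal T_+(P)$. For $\ell\ge1$, $M_\ell(\mathcal T_+(P))\subseteq M_\ell(B(\mathcal H_P))\cong B(\bigoplus_{n=1}^{\ell}\mathcal H_P)$ carries the operator norm, and for $T=[T_{pq}]\in M_\ell(\mathcal T_+(P))$ the matrix of restrictions $[T_{pq}|_{\mathcal H_{P,k}}]\in M_\ell(B(\mathcal H_{P,k}))\cong B(\bigoplus_{n=1}^{\ell}\mathcal H_{P,k})$ likewise carries the operator norm. Escorted: a state $k\in\Omega$ is escorted if for every $s\in\Omega$ with $P_{ks}>0$ there exists $k'\in\Omega$ with $k'\neq k$ and $P_{k's}>0$. *)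

(* Defs.v *)
From HB Require Import structures.
From mathcomp Require Import all_boot all_order all_algebra.
From mathcomp Require Import complex ring lra.
From mathcomp Require Import all_classical all_reals all_analysis.

Set Implicit Arguments.
Unset Strict Implicit.
Unset Printing Implicit Defensive.

Import Order.TTheory GRing.Theory Num.Theory.
Import Normc.

Local Open Scope classical_set_scope.
Local Open Scope complex_scope.
Local Open Scope ring_scope.

Section StochasticMatrices.
Variables (R : realType) (Omega : finType).
Implicit Types P : Omega -> Omega -> R.

Definition stochastic P : Prop :=
  (forall i j, 0 <= P i j <= 1) /\ (forall i, \sum_j P i j = 1).

Fixpoint mpow P (n : nat) (i j : Omega) : R :=
  if n is n'.+1 then \sum_h P i h * mpow P n' h j else (i == j)%:R.

Definition Gr P : rel Omega := fun i j => 0 < P i j.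

(* A strongly connected graph is understood to have at least one vertex. *)
Definition irreducible P : Prop :=
  (0 < #|Omega|)%N /\ forall i j, connect (Gr P) i j.

(* The vertices can be listed without repetition so that the edges are exactly
   those from each vertex to its cyclic successor; for a one-vertex list that
   edge is a loop. *)
Definition is_cycle P : Prop :=
  exists c : seq Omega,
    [/\ uniq c, forall i, i \in c & forall i j, Gr P i j = (next c i == j)].

Definition escorted P (k : Omega) : Prop :=
  forall s, 0 < P k s -> exists k', k' != k /\ 0 < P k' s.

End StochasticMatrices.

Section Ell2.
Variables (R : realType) (I : choiceType).

Definition sqmod (f : I -> R[i]) (i : I) : \bar R := ((normc (f i)) ^+ 2)%:E.

Definition sqsummable : {pred I -> R[i]} :=
  fun f => `[< summable [set: I] (sqmod f) >].

Lemma sqmod_ge0 f i : (0 <= sqmod f i)%E.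
Proof. by rewrite lee_fin sqr_ge0. Qed.

Lemma sqsummableP f :
  f \in sqsummable <-> (\esum_(i in [set: I]) sqmod f i < +oo)%E.
Proof.
rewrite unfold_in asboolE /summable.
by rewrite (@eq_esum _ _ _ _ (sqmod f))// => i _; rewrite gee0_abs ?sqmod_ge0.
Qed.

Lemma esumZl_le (D : set I) (c : R) (a : I -> \bar R) :
  0 <= c -> (forall i, 0 <= a i)%E ->
  (\esum_(i in D) (c%:E * a i) <= c%:E * \esum_(i in D) a i)%E.
Proof.
move=> c0 a0; apply: ge_ereal_sup => _ [F [finF FD] <-].
rewrite -ge0_mule_fsumr//; apply: lee_wpmul2l; first by rewrite lee_fin.
by apply: esum_ge; exists F.
Qed.

Lemma sqsummable_submod : submod_closed sqsummable.
Proof.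
split=> [|a u v /sqsummableP su /sqsummableP sv]; apply/sqsummableP.
  by rewrite esum1 ?ltry// => i _; rewrite /sqmod normc0 expr0n.
set c := 2 * normc a ^+ 2.
have c0 : 0 <= c by rewrite mulr_ge0 ?sqr_ge0.
apply: (@le_lt_trans _ _
    (\esum_(i in [set: I]) (c%:E * sqmod u i + 2%:E * sqmod v i))%E).
  apply: le_esum => i _; rewrite /sqmod -!EFinM -EFinD lee_fin /=.
  have -> : (a *: u + v) i = a * u i + v i by [].
  have := le_normcD (a * u i) (v i); rewrite normcM /c.
  have: 0 <= normc (a * u i + v i) by case: (_ + _) => *; exact: sqrtr_ge0.
  move: (normc (_ + _)) (normc a) (normc (u i)) (normc (v i)) => x y z t x0 xle.
  have : x ^+ 2 <= (y * z + t) ^+ 2 by apply: lerXn2r; rewrite ?nnegrE//; exact: (le_trans x0 xle).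
  have := sqr_ge0 (y * z - t); rewrite sqrrB sqrrD exprMn; lra.
rewrite esumD; last 2 first.
- by move=> i _; rewrite mule_ge0 ?sqmod_ge0// lee_fin.
- by move=> i _; rewrite mule_ge0 ?sqmod_ge0// lee_fin.
apply: lte_add_pinfty; (apply: le_lt_trans; first apply: esumZl_le => //).
- exact: sqmod_ge0.
- by rewrite lte_mul_pinfty// lee_fin.
- exact: sqmod_ge0.
- by rewrite lte_mul_pinfty// lee_fin.
Qed.

HB.instance Definition _ :=
  GRing.isSubmodClosed.Build R[i] (I -> R[i]) sqsummable sqsummable_submod.

Record ell2 := Ell2 { ell2_fun :> I -> R[i]; _ : ell2_fun \in sqsummable }.

HB.instance Definition _ := [isSub for ell2_fun].
HB.instance Definition _ := [Choice of ell2 by <:].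
HB.instance Definition _ := [SubChoice_isSubLmodule of ell2 by <:].

Definition ell2_norm (x : ell2) : R :=
  Num.sqrt (fine (\esum_(i in [set: I]) sqmod x i)).

Lemma delta_sqsummable (i0 : I) :
  (fun i => (i == i0)%:R : R[i]) \in sqsummable.
Proof.
apply/sqsummableP.
have -> : (\esum_(i in [set: I]) sqmod (fun i => (i == i0)%:R) i =
           \esum_(i in [set i0]) 1%:E :> \bar R)%E.
  rewrite [RHS]esum_mkcond; apply: eq_esum => i _; rewrite /sqmod in_set1.
  by case: eqP => _; rewrite ?normc1 ?normc0 ?expr1n ?expr0n.
by rewrite esum_set1 ?ltry// lee_fin.
Qed.

Definition basis_vec (i0 : I) : ell2 := Ell2 (delta_sqsummable i0).

Definition bounded_op : set (ell2 -> ell2) :=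
  [set f | linear f /\
           exists M : R, forall x, ell2_norm (f x) <= M * ell2_norm x].

(* [sup] of an unbounded set is a dummy value, so this (like [mx_opnorm] below)
   is meaningful only for bounded operators. *)
Definition opnorm (f : ell2 -> ell2) : R :=
  sup [set ell2_norm (f x) | x in [set x | ell2_norm x <= 1]].

Definition norm_closed (A : set (ell2 -> ell2)) : Prop :=
  forall f, bounded_op f ->
    (forall e : R, 0 < e -> exists g, A g /\ opnorm (f - g) < e) -> A f.

Definition closed_subalgebra (A : set (ell2 -> ell2)) : Prop :=
  [/\ A `<=` bounded_op, A 0,
      forall (a : R[i]) f g, A f -> A g -> A (a *: f + g),
      forall f g, A f -> A g -> A (f \o g) & norm_closed A].

Definition dsum_norm (l : nat) (x : 'I_l -> ell2) : R :=
  Num.sqrt (\sum_(q < l) ell2_norm (x q) ^+ 2).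

(* For a subspace V invariant under all the T p q, the norm of the matrix of
   restrictions of the T p q to V, acting on the direct sum of l copies of V. *)
Definition mx_opnorm (l : nat) (V : set ell2) (T : 'M[ell2 -> ell2]_l) : R :=
  sup [set dsum_norm (fun p => \sum_(q < l) T p q (x q)) |
        x in [set x : 'I_l -> ell2 | (forall q, V (x q)) /\ dsum_norm x <= 1]].

End Ell2.

Section TensorAlgebra.
Variables (R : realType) (Omega : finType) (P : Omega -> Omega -> R).

(* (m, j, k) indexes the basis vector xi_{m,j,k}. *)
Definition Gr_index : choiceType :=
  {t : nat * Omega * Omega | 0 < mpow P t.1.1 t.1.2 t.2}.

Definition HP := ell2 R Gr_index.

(* Total in (m, j, k); the value 0 is used off the index set. *)
Definition xi (m : nat) (j k : Omega) : HP :=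
  if insub (m, j, k) is Some t then basis_vec R t else 0.

Definition HPk (k : Omega) : set HP :=
  [set x | forall t : Gr_index, (val t).2 != k -> x t = 0].

(* A bounded operator is determined by its values on the basis vectors. *)
Definition is_S (n : nat) (i j : Omega) (f : HP -> HP) : Prop :=
  bounded_op f /\
  forall m j' k, 0 < mpow P m j' k ->
    f (xi m j' k) =
      if j == j' then
        (Num.sqrt (mpow P n i j * mpow P m j k / mpow P (n + m) i k))%:C
          *: xi (n + m) i k
      else 0.

Definition S_ops : set (HP -> HP) :=
  [set f | exists n i j, 0 < mpow P n i j /\ is_S n i j f].

Definition tensor_algebra : set (HP -> HP) :=
  smallest (@closed_subalgebra R Gr_index) S_ops.

End TensorAlgebra.

Arguments HPk {R Omega} P k _.
Arguments xi {R Omega} P m j k.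
Arguments is_S {R Omega} P n i j f.
Arguments S_ops {R Omega} P _.
Arguments tensor_algebra {R Omega} P _.

Definition is_max (R : realType) (A : set R) (x : R) : Prop :=
  A x /\ ubound A x.

(* Main.v *)
(** If [k] is the sole predecessor of a state [s], then
[P^(m+1)_(js) = P^(m)_(jk) * P_(ks)], so that [xi_(m,j,k) |-> xi_(m+1,j,s)]
extends to an isometry of [HPk k] into [HPk s] which intertwines the operators
[S^(n)_(ij)]: the factor [P_(ks)] cancels in their coefficients.  Hence the
restriction to [HPk k] is dominated in norm by the restriction to [HPk s].  A
state which is not escorted has such a successor [s]; following these successors
ends in an escorted state, unless they close up, in which case irreducibility
makes [P] a cycle.  Finally, the subspaces [HPk k] being reducing, the norm is
the maximum over all [k]. *)

From HB Require Import structures.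
Require Import Defs.
From mathcomp Require Import all_boot all_order all_algebra.
From mathcomp Require Import complex lra.
From mathcomp Require Import all_classical all_reals all_analysis.

Set Implicit Arguments.
Unset Strict Implicit.
Unset Printing Implicit Defensive.

Import Order.TTheory GRing.Theory Num.Theory.
Import Normc.

Local Open Scope classical_set_scope.
Local Open Scope complex_scope.
Local Open Scope ring_scope.

(** * Sole predecessors *)

Section Combinatorics.
Variables (R : realType) (Omega : finType).
Implicit Types P : Omega -> Omega -> R.

Definition sole_predecessor P (k s : Omega) : Prop :=
  0 < P k s /\ forall k', 0 < P k' s -> k' = k.

Lemma not_escorted P k : ~ escorted P k -> exists s, sole_predecessor P k s.
Proof.
move=> /existsNP[s] /not_implyP[ks /forallNP nk'].
exists s; split=> // k' k's; apply/eqP/negPn/negP => k'k.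
exact: (nk' k').
Qed.

(** Strong connectivity gives a directed path from [i] to [j]; membership in [U] is carried back
    along it from its end. *)
Lemma predecessor_closed P (U : pred Omega) (j : Omega) :
  irreducible P -> U j -> (forall i k, 0 < P i k -> U k -> U i) -> forall i, U i.
Proof.
move=> [_ conn] Uj Uclosed i; have /connectP[p] := conn i j.
elim: p i => [|h p IHp] i /=; first by move=> _ <-.
by move=> /andP[ih hp] jE; apply: (Uclosed _ h) => //; exact: IHp.
Qed.

(** Two states with the same image under [f] are both its sole predecessor, so [f] is a permutation.
    Its functional graph is all of [Gr P], and connectivity leaves room for a single orbit, which
    lists the cycle. *)
Lemma sole_predecessor_cycle P (f : Omega -> Omega) :
  irreducible P -> (forall k, sole_predecessor P k (f k)) -> is_cycle P.
Proof.
move=> irrP fP; have [/card_gt0P[k _] conn] := irrP.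
have f_inj : injective f.
  by move=> i j fij; apply: (fP j).2; rewrite -fij; exact: (fP i).1.
have GrE i j : Gr P i j = (f i == j).
  apply/idP/eqP => [|<-]; last exact: (fP i).1.
  (* An injective self-map of a finite set is onto, so [j] is a value of [f] and has [finv f j] as
     its sole predecessor. *)
  by rewrite -(f_finv f_inj j) => /(fP _).2 ->.
have orbT i : i \in fingraph.orbit f k.
  by rewrite -fconnect_orbit -(eq_connect GrE).
exists (fingraph.orbit f k); split=> [||i j]; first exact: orbit_uniq.
  exact: orbT.
by rewrite GrE (eqP (next_cycle (cycle_orbit f_inj k) (orbT i))).
Qed.

(* Otherwise the maximizers of [M] are permuted by a choice of successors with a
   sole predecessor, hence closed under predecessors; so they exhaust [Omega],
   and [P] is a cycle. *)
Lemma escorted_maximizer P (M : Omega -> R) :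
  irreducible P -> ~ is_cycle P ->
  (forall k s, sole_predecessor P k s -> M k <= M s) ->
  exists2 e, escorted P e & forall k, M k <= M e.
Proof.
move=> irrP ncycP leM; apply: contrapT => noe.
have [/card_gt0P[k0 _] _] := irrP.
case: (@Order.TotalTheory.arg_maxP _ _ _ k0 xpredT M isT) => m _ maxm0.
have {maxm0} maxm j : M j <= M m := maxm0 j isT.
pose U := [set k | M k == M m]%SET.
have UP k : k \in U -> forall j, M j <= M k.
  by rewrite inE => /eqP -> j; exact: maxm.
have /choice[f fP] k : exists s, k \in U -> sole_predecessor P k s.
  have [kU|kU] := boolP (k \in U); last by exists k.
  (* A maximizer cannot be escorted, by [noe], so it has a successor of which it is the sole
     predecessor. *)
  have [|s ksP] := @not_escorted P k; last by exists s.
  by move=> ke; apply: noe; exists k => //; exact: UP.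
have fU k : k \in U -> f k \in U.
  move=> kU; rewrite inE eq_le maxm/=.
  by move: (kU); rewrite inE => /eqP <-; exact: leM (fP _ kU).
have f_inj : {in U &, injective f}.
  move=> i j iU jU fij; apply: (fP j jU).2.
  by rewrite -fij; exact: (fP i iU).1.
have fUE : (f @: U)%SET = U.
  apply/eqP; rewrite eqEcard card_in_imset// leqnn andbT.
  by apply/fintype.subsetP => _ /imsetP[k kU ->]; exact: fU.
have UT : forall k, k \in U.
  apply: (@predecessor_closed P (mem U) m) => //=; first by rewrite inE.
  move=> i j ij jU; have /imsetP[k kU jE] : j \in (f @: U)%SET by rewrite fUE.
  by rewrite /= ((fP k kU).2 i) -?jE.
by apply: ncycP; apply: (@sole_predecessor_cycle P f) => // k; exact: fP.
Qed.

End Combinatorics.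

(** * Powers of a nonnegative matrix *)

Section Mpow.
Variables (R : realType) (Omega : finType) (P : Omega -> Omega -> R).
Hypothesis P_ge0 : forall i j, 0 <= P i j.

Lemma mpow_ge0 n i j : 0 <= mpow P n i j.
Proof.
elim: n i => [|n IHn] i /=; first by rewrite ler0n.
by apply: sumr_ge0 => h _; rewrite mulr_ge0.
Qed.

Lemma mpowD n m i k : mpow P (n + m) i k = \sum_j mpow P n i j * mpow P m j k.
Proof.
elim: n i => [|n IHn] i /=.
  rewrite (bigD1 i)//= eqxx mul1r big1 ?addr0// => j /negbTE ji.
  by rewrite eq_sym ji mul0r.
under eq_bigr do rewrite IHn mulr_sumr.
rewrite exchange_big/=; apply: eq_bigr => j _.
by rewrite mulr_suml; apply: eq_bigr => h _; rewrite mulrA.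
Qed.

Lemma mpowD_gt0 n m i j k :
  0 < mpow P n i j -> 0 < mpow P m j k -> 0 < mpow P (n + m) i k.
Proof.
move=> ij jk; rewrite mpowD (bigD1 j)//=.
apply: (lt_le_trans (mulr_gt0 ij jk)); rewrite lerDl.
by apply: sumr_ge0 => h _; rewrite mulr_ge0 ?mpow_ge0.
Qed.

(** The last step of a walk ending in [s] must leave from [k]: in the sum over the penultimate state
    all other terms vanish. *)
Lemma mpowS_sole k s m j : sole_predecessor P k s ->
  mpow P m.+1 j s = mpow P m j k * P k s.
Proof.
(* [mpow] peels off the first step of a walk; the form [m + 1] lets [mpowD] peel off the last
   one. *)
move=> [_ ks]; rewrite -addn1 mpowD.
have mpow1 h : mpow P 1 h s = P h s.
  rewrite /= (bigD1 s)//= eqxx mulr1 big1 ?addr0// => i /negbTE ->.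
  by rewrite mulr0.
rewrite (bigD1 k)// mpow1 /= big1 ?addr0// => h hk.
have : P h s <= 0 by rewrite leNgt; apply: contraNN hk => /ks ->.
rewrite -/(mpow P 1 h s) mpow1 => Phs.
by rewrite (@le_anti _ _ (P h s) 0) ?mulr0// Phs P_ge0.
Qed.

End Mpow.

(** * Bounded operators on square-summable families *)

Section Ell2Norm.
Variables (R : realType) (I : choiceType).
Local Notation ell2 := (ell2 R I).
Implicit Types (x y : ell2) (i : I) (a : R[i]).

Lemma normc_ge0 a : 0 <= normc a.
Proof. by case: a => *; exact: sqrtr_ge0. Qed.

Lemma ell2P x y : (forall i, x i = y i) -> x = y.
Proof. by move=> xy; apply/val_inj/funext. Qed.

Lemma ell2_addE x y i : (x + y) i = x i + y i. Proof. by []. Qed.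
Lemma ell2_oppE x i : (- x) i = - x i. Proof. by []. Qed.
Lemma ell2_scaleE a x i : (a *: x) i = a * x i. Proof. by []. Qed.
Lemma ell2_zeroE i : (0 : ell2) i = 0. Proof. by []. Qed.

Lemma ell2_norm_ge0 x : 0 <= ell2_norm x.
Proof. exact: sqrtr_ge0. Qed.

Lemma esum_sqmod x :
  (\esum_(i in [set: I]) sqmod x i = (ell2_norm x ^+ 2)%:E)%E.
Proof.
have x0 : (0 <= \esum_(i in [set: I]) sqmod x i)%E.
  by apply: esum_ge0 => i _; exact: sqmod_ge0.
rewrite sqr_sqrtr ?fine_ge0// fineK// ge0_fin_numE//.
by apply/sqsummableP; case: x {x0}.
Qed.

Lemma normc_le_norm x i : normc (x i) <= ell2_norm x.
Proof.
rewrite -ler_sqr ?nnegrE ?normc_ge0 ?ell2_norm_ge0//.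
rewrite -lee_fin -esum_sqmod -/(sqmod x i).
rewrite (esumID [set i])//; last by move=> *; exact: sqmod_ge0.
rewrite setTI esum_set1 ?sqmod_ge0// leeDl// esum_ge0// => *; exact: sqmod_ge0.
Qed.

Lemma le_ell2_norm x y (c : R) : 0 <= c ->
  (forall i, normc (x i) <= c * normc (y i)) -> ell2_norm x <= c * ell2_norm y.
Proof.
move=> c0 xy.
rewrite -ler_sqr ?nnegrE ?mulr_ge0 ?ell2_norm_ge0// exprMn.
rewrite -lee_fin (EFinM (c ^+ 2)) -!esum_sqmod.
apply: le_trans (esumZl_le _ (sqr_ge0 c) (sqmod_ge0 y)).
apply: le_esum => i _; rewrite /sqmod -EFinM lee_fin -exprMn.
by rewrite lerXn2r ?nnegrE ?mulr_ge0 ?normc_ge0.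
Qed.

Lemma ell2_norm0 : ell2_norm (0 : ell2) = 0.
Proof.
apply/le_anti; rewrite ell2_norm_ge0 andbT -[leRHS](mul0r (ell2_norm (0 : ell2))).
by apply: le_ell2_norm => // i; rewrite ell2_zeroE normc0 mul0r.
Qed.

Lemma ell2_normZ a x : ell2_norm (a *: x) = normc a * ell2_norm x.
Proof.
have le_normZ b y : ell2_norm (b *: y) <= normc b * ell2_norm y.
  by apply: le_ell2_norm (normc_ge0 b) _ => i; rewrite ell2_scaleE normcM.
have [->|a0] := eqVneq a 0; first by rewrite scale0r ell2_norm0 normc0 mul0r.
have na0 : 0 < normc a.
  by rewrite lt_def normc_ge0 andbT; apply: contraNneq a0 => /eq0_normc ->.
(* The reverse inequality is the upper bound for the scalar [a^-1] acting on [a *: x]. *)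
apply/le_anti; rewrite le_normZ/= -ler_pdivlMl// -normcV.
by apply: le_trans (le_normZ _ _); rewrite scalerA mulVf// scale1r.
Qed.

(* A weak triangle inequality is all that is needed, since norms of sums are
   only ever shown to be finite or small. *)
Lemma ell2_norm_add x y : ell2_norm (x + y) <= 2 * (ell2_norm x + ell2_norm y).
Proof.
have x0 := ell2_norm_ge0 x; have y0 := ell2_norm_ge0 y.
suff le2 : ell2_norm (x + y) ^+ 2 <= 2 * ell2_norm x ^+ 2 + 2 * ell2_norm y ^+ 2.
  rewrite -ler_sqr ?nnegrE ?mulr_ge0 ?addr_ge0 ?ell2_norm_ge0//.
  apply: le_trans le2 _; nra.
rewrite -lee_fin EFinD !(EFinM 2) -!esum_sqmod.
have ge0_2 : 0 <= 2 :> R by [].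
apply: le_trans (leeD (esumZl_le _ ge0_2 (sqmod_ge0 x))
                      (esumZl_le _ ge0_2 (sqmod_ge0 y))).
rewrite -esumD; last 2 first.
- by move=> i _; rewrite mule_ge0 ?sqmod_ge0 ?lee_fin.
- by move=> i _; rewrite mule_ge0 ?sqmod_ge0 ?lee_fin.
apply: le_esum => i _; rewrite /sqmod -!EFinM -EFinD lee_fin ell2_addE.
have aux (u v w : R) : 0 <= u -> 0 <= v -> 0 <= w -> w <= u + v ->
    w ^+ 2 <= 2 * u ^+ 2 + 2 * v ^+ 2.
  by move=> u0 v0 w0 le; have := sqr_ge0 (u - v); nra.
by apply: aux; rewrite ?normc_ge0 ?le_normcD.
Qed.

End Ell2Norm.

(** Bundles a function that is merely proved linear, so that the generic theory of linear maps
    applies to it. *)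
Lemma linear_fun_linear (K : pzRingType) (U V : lmodType K) (f : U -> V) :
  linear f -> exists g : {linear U -> V}, f = g.
Proof.
move=> lf; pose fM := GRing.isLinear.Build K U V *:%R f lf.
by exists (HB.pack_for {linear U -> V} f fM).
Qed.

Lemma normc_real (R : realType) (r : R) : normc r%:C = `|r|.
Proof. by rewrite /normc/= expr0n/= addr0 sqrtr_sqr. Qed.

(** * Suprema of homogeneous functions over a unit ball *)

Section HomogeneousSup.
Variables (R : realType) (E : lmodType R[i]) (N G : E -> R) (V : set E) (M : R).
Hypothesis N_ge0 : forall x, 0 <= N x.
Hypothesis NZ : forall a x, N (a *: x) = normc a * N x.
Hypothesis GZ : forall a x, G (a *: x) = normc a * G x.
Hypothesis VZ : forall a x, V x -> V (a *: x).
Hypothesis G_le : forall x, V x -> G x <= M * N x.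

(** Rescale [x] to norm 1. The bound [G_le] makes the supremum a genuine one and settles the case
    [N x = 0]. Both [opnorm] and [mx_opnorm] are instances. *)
Lemma le_sup_homogeneous x : V x ->
  G x <= sup [set G z | z in [set z | V z /\ N z <= 1]] * N x.
Proof.
move=> Vx; have [Nx0|Nx0] := eqVneq (N x) 0.
  by have := G_le Vx; rewrite Nx0 !mulr0.
have Nx_gt0 : 0 < N x by rewrite lt_def Nx0 N_ge0.
have nc : normc ((N x)^-1)%:C = (N x)^-1.
  by rewrite normc_real ger0_norm// invr_ge0.
rewrite -ler_pdivrMr// mulrC -nc -GZ.
apply: ub_le_sup; last first.
  by exists (((N x)^-1)%:C *: x) => //; split; [exact: VZ|rewrite NZ nc mulVf].
exists (`|M|) => _ [z [Vz Nz] <-]; apply: le_trans (G_le Vz) _.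
apply: (@le_trans _ _ (`|M| * N z)); first by rewrite ler_wpM2r// ler_norm.
by rewrite ler_piMr.
Qed.

End HomogeneousSup.

(** * Bounded operators, commutants and density of finite combinations *)

Section BoundedOperators.
Variables (R : realType) (I : choiceType).
Local Notation ell2 := (ell2 R I).
Implicit Types (x y : ell2) (i : I) (a : R[i]) (f g W : ell2 -> ell2).

Lemma bounded_op_linear f : bounded_op f ->
  exists f' : {linear ell2 -> ell2}, f = f'.
Proof. by move=> [/linear_fun_linear]. Qed.

Lemma bounded_op_bound f : bounded_op f ->
  exists2 M : R, 0 <= M & forall x, ell2_norm (f x) <= M * ell2_norm x.
Proof.
move=> [_ [M fM]]; exists `|M| => // x; apply: le_trans (fM x) _.
by rewrite ler_wpM2r ?ell2_norm_ge0// ler_norm.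
Qed.

Lemma le_opnorm f x : bounded_op f -> ell2_norm (f x) <= opnorm f * ell2_norm x.
Proof.
move=> bf; have [f' fE] := bounded_op_linear bf; have [M _ fM] := bounded_op_bound bf.
rewrite /opnorm; have -> : [set x | ell2_norm x <= 1] =
    [set z : ell2 | setT z /\ ell2_norm z <= 1].
  by apply/seteqP; split=> z //= [].
apply: (@le_sup_homogeneous R ell2 (@ell2_norm R I)
  (fun z => ell2_norm (f z)) setT M) => //.
- exact: ell2_norm_ge0.
- exact: ell2_normZ.
- by move=> a z; rewrite fE linearZ ell2_normZ.
Qed.

Lemma bounded_op0 : bounded_op (0 : ell2 -> ell2).
Proof.
split=> [a x y|]; first by rewrite /= scaler0 addr0.
by exists 0 => x; rewrite mul0r ell2_norm0.
Qed.

Lemma bounded_op_lin a f g :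
  bounded_op f -> bounded_op g -> bounded_op (a *: f + g).
Proof.
move=> bf bg; have [M M0 fM] := bounded_op_bound bf.
have [N N0 gN] := bounded_op_bound bg; split.
  move: bf.1 bg.1 => lf lg b x y.
  change (a *: f (b *: x + y) + g (b *: x + y) =
          b *: (a *: f x + g x) + (a *: f y + g y)).
  rewrite lf lg !scalerDr !scalerA mulrC -!addrA; congr (_ + _).
  by rewrite addrCA.
exists (2 * (normc a * M + N)) => x.
apply: le_trans (ell2_norm_add (a *: f x) (g x)) _.
rewrite -mulrA ler_wpM2l// mulrDl lerD// ell2_normZ -mulrA.
by rewrite ler_wpM2l ?normc_ge0.
Qed.

Lemma bounded_opB f g : bounded_op f -> bounded_op g -> bounded_op (f - g).
Proof. by move=> bf bg; rewrite addrC -scaleN1r; exact: bounded_op_lin. Qed.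

Lemma bounded_op_comp f g : bounded_op f -> bounded_op g -> bounded_op (f \o g).
Proof.
move=> bf bg; have [M M0 fM] := bounded_op_bound bf.
have [N N0 gN] := bounded_op_bound bg; split.
  by move=> b x y /=; rewrite bg.1 bf.1.
by exists (M * N) => x /=; rewrite (le_trans (fM _))// -mulrA ler_wpM2l.
Qed.

(** Makes the bounded operators one of the sets intersected in [tensor_algebra], whose elements are
    therefore bounded. *)
Lemma closed_subalgebra_bounded_op : closed_subalgebra (@bounded_op R I).
Proof.
split=> //; [exact: bounded_op0|exact: bounded_op_lin|exact: bounded_op_comp].
Qed.

Lemma normc_le_eps_eq0 (z : R[i]) (C : R) :
  (forall e : R, 0 < e -> normc z <= e * C) -> z = 0.
Proof.
move=> zC; apply: eq0_normc; apply/le_anti; rewrite normc_ge0 andbT.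
rewrite leNgt; apply/negP => z0.
have C0 : 0 < C by have := zC 1 ltr01; rewrite mul1r; exact: lt_le_trans.
(* For this [e] the bound [e * C] is half of [normc z]. *)
have /zC : 0 < normc z / (2 * C) by rewrite divr_gt0// mulr_gt0.
rewrite leNgt => /negP; apply; rewrite -mulrA invfM -mulrA mulVf ?gt_eqF// mulr1.
by rewrite ltr_pdivrMr// ltr_pMr// ltr1n.
Qed.

(** Reduces commutation with [W] to generators. For norm-closedness: if [g] commutes with [W], the
    commutator of [f] with [W] is that of [f - g], whose coordinates are small with
    [opnorm (f - g)]. *)
Lemma closed_subalgebra_commutant W : bounded_op W ->
  closed_subalgebra [set f | bounded_op f /\ forall x, f (W x) = W (f x)].
Proof.
move=> bW; have [W' WE] := bounded_op_linear bW.
have [M M0 WM] := bounded_op_bound bW; split.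
- by move=> f [].
- by split=> [|x]; [exact: bounded_op0|rewrite WE linear0].
- move=> a f g [bf fW] [bg gW]; split=> [|x]; first exact: bounded_op_lin.
  change (a *: f (W x) + g (W x) = W (a *: f x + g x)).
  by rewrite bW.1 fW gW.
- move=> f g [bf fW] [bg gW]; split=> [|x]; first exact: bounded_op_comp.
  by rewrite /= gW fW.
move=> f bf fapp; split=> // x; apply: ell2P => i.
apply/eqP; rewrite -subr_eq0; apply/eqP.
(* The two summands bound [(f - g) (W x)] and [W ((f - g) x)], up to the factor [e]. *)
apply: (@normc_le_eps_eq0 _ (ell2_norm (W x) + M * ell2_norm x)) => e e0.
have [g [[bg gW] fg]] := fapp e e0.
have small y : ell2_norm ((f - g) y) <= e * ell2_norm y.
  apply: le_trans (le_opnorm y (bounded_opB bf bg)) _.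
  by rewrite ler_wpM2r ?ell2_norm_ge0// ltW.
have -> : f (W x) i - W (f x) i = (f - g) (W x) i - W ((f - g) x) i.
  change (f (W x) i - W (f x) i = (f (W x) - g (W x)) i - W (f x - g x) i).
  by rewrite WE linearB -WE gW !ell2_addE !ell2_oppE opprB addrA subrK.
apply: le_trans (le_normcD _ _) _; rewrite normcN mulrDr lerD//.
  exact: le_trans (normc_le_norm _ _) (small _).
apply: le_trans (normc_le_norm _ _) _; apply: le_trans (WM _) _.
by rewrite mulrCA ler_wpM2l.
Qed.

Lemma ell2_sumE (J : Type) (r : seq J) (p : pred J) (F : J -> ell2) i :
  (\sum_(j <- r | p j) F j) i = \sum_(j <- r | p j) F j i.
Proof. exact: (big_morph (fun x : ell2 => x i)). Qed.

(** Truncate [x] to a finite set [F] whose partial sum comes within [e ^+ 2] of the squared norm;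
    the remainder lives off [F], and its squared norm is the missing part of the sum. *)
Lemma finite_approx x (e : R) : 0 < e ->
  exists s : seq I, ell2_norm (x - \sum_(i <- s) x i *: basis_vec R i) <= e.
Proof.
move=> e0; have e20 : 0 < e ^+ 2 by rewrite exprn_gt0.
have fin : (\esum_(i in [set: I]) sqmod x i \is a fin_num)%E by rewrite esum_sqmod.
have [_ [F [finF _] <-] ltF] := ub_ereal_sup_adherent e20 fin.
exists (finmap.enum_fset (fset_set F)); set y := (x - _).
have yE j : y j = if j \in ~` F then x j else 0.
  rewrite /y ell2_addE ell2_oppE ell2_sumE in_setC.
  under eq_bigr do rewrite ell2_scaleE /=.
  have [jF|jF] := boolP (j \in F) => /=.
    rewrite (bigD1_seq j) ?finmap.fset_uniq ?in_fset_set//= eqxx mulr1 big1.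
      by rewrite addr0 subrr.
    by move=> i; rewrite eq_sym => /negbTE ->; rewrite mulr0.
  rewrite big1_seq ?subr0// => i /=; rewrite in_fset_set// => iF.
  by have [ji|] := eqVneq j i; [move: jF; rewrite ji iF|rewrite mulr0].
have split_sum : ((ell2_norm x ^+ 2)%:E =
    \sum_(i \in F) sqmod x i + (ell2_norm y ^+ 2)%:E)%E.
  rewrite -!esum_sqmod (esumID F)//; last by move=> *; exact: sqmod_ge0.
  rewrite !setTI esum_fset//; last by move=> *; exact: sqmod_ge0.
  congr (_ + _)%E; rewrite esum_mkcond; apply: eq_esum => i _.
  by rewrite /sqmod yE; case: ifP; rewrite ?normc0 ?expr0n.
rewrite -ler_sqr ?nnegrE ?ell2_norm_ge0 ?ltW//.
move: ltF; rewrite -/(esum _ _) esum_sqmod split_sum.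
case: (\sum_(i \in F) _)%E split_sum => [s| |] //= _.
by rewrite -!EFinD lte_fin => ?; lra.
Qed.

(** The difference [h] kills finite combinations of basis vectors, so [h x] equals [h] of an
    arbitrarily small remainder. *)
Lemma bounded_op_ext f g : bounded_op f -> bounded_op g ->
  (forall i, f (basis_vec R i) = g (basis_vec R i)) -> forall x, f x = g x.
Proof.
move=> bf bg fg x; have bh := bounded_opB bf bg.
have [h hE] := bounded_op_linear bh; have [M M0 hM] := bounded_op_bound bh.
have h0 i : h (basis_vec R i) = 0.
  rewrite -hE; change (f (basis_vec R i) - g (basis_vec R i) = 0).
  by rewrite fg subrr.
have hx i : h x i = 0.
  apply: (@normc_le_eps_eq0 _ M) => e e0.
  have [s sP] := finite_approx x e0.
  have -> : h x = h (x - \sum_(i <- s) x i *: basis_vec R i).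
    rewrite linearB linear_sum big1 ?subr0// => j _.
    by rewrite linearZ/= h0 scaler0.
  rewrite (le_trans (normc_le_norm _ _))// -hE (le_trans (hM _))// mulrC.
  by rewrite ler_wpM2r.
apply/eqP; rewrite -subr_eq0; apply/eqP.
change ((f - g) x = 0); rewrite hE; by apply: ell2P => i; rewrite hx.
Qed.

End BoundedOperators.

(** * Partial isometries induced by partial injections of the index set *)

Section PartialReindexing.
Variables (R : realType) (I : choiceType) (phi : I -> option I).
Hypothesis phi_inj :
  forall t t' u, phi t = Some u -> phi t' = Some u -> t = t'.
Local Notation ell2 := (ell2 R I).
Implicit Types (x y : ell2) (t u : I).

(** The index map is given backwards, from target to source, so that the operator has a
    coordinatewise formula. It sends the basis vector at [u] to the one at [t] when
    [phi t = Some u], and to 0 when there is no such [t]. *)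
Definition pull_fun (x : I -> R[i]) (t : I) : R[i] := oapp x 0 (phi t).

Lemma esum_pull_fun (x : I -> R[i]) :
  (\esum_(t in [set: I]) sqmod (pull_fun x) t =
   \esum_(u in [set u | exists t, phi t = Some u]) sqmod x u)%E.
Proof.
(* [e] makes [phi] total; its default value is only taken off [D]. *)
pose e t := odflt t (phi t); pose D := [set t | phi t != None].
have -> : [set u | exists t, phi t = Some u] = e @` D.
  apply/seteqP; split=> [u [t tu]|_ [t /= tD <-]].
    by exists t; rewrite /D/= ?tu// /e tu.
  by move: tD; rewrite /D/= /e; case tE : (phi t) => [u|]//= _; exists t.
rewrite esum_image; last first.
  move=> t t' /set_mem/= + /set_mem/=; rewrite /D /= /e.
  case tE : (phi t) => [u|]//= _; case tE' : (phi t') => [u'|]//= _ uu'.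
  by rewrite -uu' in tE'; exact: phi_inj tE tE'.
rewrite [RHS]esum_mkcond; apply: eq_esum => t _.
have -> : (t \in D) = (phi t != None) by apply/idP/idP; rewrite inE.
by rewrite /sqmod /pull_fun /e; case: (phi t) => [u|] //; rewrite /oapp normc0 expr0n.
Qed.

Lemma pull_sqsummable x : pull_fun x \in @sqsummable R I.
Proof.
apply/sqsummableP; rewrite esum_pull_fun.
have : (\esum_(i in [set: I]) sqmod x i < +oo)%E by rewrite esum_sqmod ltry.
apply: le_lt_trans; rewrite esum_mkcond; apply: le_esum => i _.
by case: ifP => // _; exact: sqmod_ge0.
Qed.

Definition pull x : ell2 := Ell2 (pull_sqsummable x).

Lemma pullE x t : pull x t = oapp x 0 (phi t). Proof. by []. Qed.

(** By [esum_pull_fun] only the coordinates outside the range of [phi] are lost, and these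
    vanish. *)
Lemma pull_norm x : (forall u, (forall t, phi t <> Some u) -> x u = 0) ->
  ell2_norm (pull x) = ell2_norm x.
Proof.
move=> supp; congr (Num.sqrt (fine _)); rewrite [LHS]esum_pull_fun esum_mkcond.
apply: eq_esum => u _; case: ifPn => // uD.
rewrite /sqmod supp ?normc0 ?expr0n// => t tu.
by move/negP: uD; apply; rewrite inE /=; exists t.
Qed.

Lemma bounded_op_pull : bounded_op pull.
Proof.
split=> [a x y|].
  apply: ell2P => t; rewrite ell2_addE ell2_scaleE !pullE.
  by case: (phi t) => //=; rewrite mulr0 addr0.
exists 1 => x; rewrite mul1r -ler_sqr ?nnegrE ?ell2_norm_ge0//.
rewrite -lee_fin -!esum_sqmod [leLHS]esum_pull_fun esum_mkcond.
by apply: le_esum => u _; case: ifP => // _; exact: sqmod_ge0.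
Qed.

Lemma pull_basis_vec t u : phi t = Some u ->
  pull (basis_vec R u) = basis_vec R t.
Proof.
move=> tu; apply: ell2P => t'; rewrite pullE/=.
case tE : (phi t') => [u'|]/=; last first.
  by case: eqP => // t't; move: tE; rewrite t't tu.
have [uu|uu] := eqVneq u' u.
  by rewrite uu in tE; rewrite (phi_inj tE tu) eqxx.
by case: eqP => // t't; move: tE uu; rewrite t't tu => -[->]; rewrite eqxx.
Qed.

Lemma pull_basis_vec0 u : (forall t, phi t <> Some u) ->
  pull (basis_vec R u) = 0.
Proof.
move=> tu; apply: ell2P => t; rewrite pullE ell2_zeroE.
case tE : (phi t) => [u'|]//=.
by case: eqP => // uu; move: (tu t); rewrite tE uu.
Qed.

End PartialReindexing.

(** * Coordinate projections *)

Section Restriction.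
Variables (R : realType) (I : choiceType).
Local Notation ell2 := (ell2 R I).

(** The partial identity on [D], which makes the coordinate projection an instance of [pull]. *)
Definition some_if (D : pred I) (t : I) : option I := if D t then Some t else None.

Lemma some_if_inj (D : pred I) t t' u :
  some_if D t = Some u -> some_if D t' = Some u -> t = t'.
Proof. by rewrite /some_if; case: ifP => // _ [->]; case: ifP => // _ [->]. Qed.

Definition restr (D : pred I) : ell2 -> ell2 := pull (@some_if_inj D).

Lemma restrE D (x : ell2) t : restr D x t = if D t then x t else 0.
Proof. by rewrite /restr pullE /some_if; case: ifP. Qed.

(** Pythagoras: each index lies in exactly one class of [c], so after exchanging the sums a single
    term survives. *)
Lemma restr_norm_sum (K : finType) (c : I -> K) (x : ell2) :
  \sum_k ell2_norm (restr (fun t => c t == k) x) ^+ 2 = ell2_norm x ^+ 2.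
Proof.
apply: EFin_inj; rewrite -sumEFin -esum_sqmod.
under eq_bigr do rewrite -esum_sqmod.
rewrite -esum_sum; last by move=> *; exact: sqmod_ge0.
apply: eq_esum => t _; rewrite (bigD1 (c t))// big1 => [|k kt].
  by rewrite [LHS]adde0 /sqmod restrE eqxx.
by rewrite /sqmod restrE eq_sym (negbTE kt) normc0 expr0n.
Qed.

End Restriction.

(** * Norms of operator matrices *)

Section MatrixNorm.
Variables (R : realType) (I : choiceType) (l : nat).
Local Notation ell2 := (ell2 R I).
Implicit Types (x y : 'I_l -> ell2) (T : 'M[ell2 -> ell2]_l) (V : set ell2).

Definition mx_app T x (p : 'I_l) : ell2 := \sum_(q < l) T p q (x q).

Lemma dsum_norm_ge0 x : 0 <= dsum_norm x. Proof. exact: sqrtr_ge0. Qed.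

Lemma dsum_norm_sqr x : dsum_norm x ^+ 2 = \sum_(q < l) ell2_norm (x q) ^+ 2.
Proof. by rewrite sqr_sqrtr// sumr_ge0// => q _; rewrite sqr_ge0. Qed.

Lemma dsum_norm0 : dsum_norm (fun _ : 'I_l => 0 : ell2) = 0.
Proof.
by rewrite /dsum_norm big1 ?sqrtr0// => q _; rewrite ell2_norm0 expr0n.
Qed.

Lemma eq_dsum_norm x y :
  (forall q, ell2_norm (x q) = ell2_norm (y q)) -> dsum_norm x = dsum_norm y.
Proof. by move=> xy; congr Num.sqrt; apply: eq_bigr => q _; rewrite xy. Qed.

Lemma dsum_normZ (a : R[i]) x : dsum_norm (a *: x) = normc a * dsum_norm x.
Proof.
rewrite /dsum_norm -[normc a](ger0_norm (normc_ge0 a)) -sqrtr_sqr -sqrtrM ?sqr_ge0//.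
congr Num.sqrt; rewrite mulr_sumr; apply: eq_bigr => q _.
by rewrite -exprMn -ell2_normZ.
Qed.

Lemma ell2_norm_le_dsum_norm x q : ell2_norm (x q) <= dsum_norm x.
Proof.
rewrite -ler_sqr ?nnegrE ?ell2_norm_ge0 ?dsum_norm_ge0// dsum_norm_sqr.
by rewrite (bigD1 q)//= lerDl sumr_ge0// => p _; rewrite sqr_ge0.
Qed.

Lemma dsum_norm_le_sum x : dsum_norm x <= \sum_(q < l) ell2_norm (x q).
Proof.
have S0 (r : seq 'I_l) : 0 <= \sum_(q <- r) ell2_norm (x q).
  by apply: sumr_ge0 => q _; exact: ell2_norm_ge0.
rewrite -ler_sqr ?nnegrE ?dsum_norm_ge0// dsum_norm_sqr.
elim: (index_enum _) => [|q r IHr]; first by rewrite !big_nil expr0n.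
rewrite !big_cons sqrrD; apply: lerD => //.
by rewrite lerDl mulrn_wge0// mulr_ge0// ell2_norm_ge0.
Qed.

Section Bounded.
Variable T : 'M[ell2 -> ell2]_l.
Hypothesis T_bounded : forall p q, bounded_op (T p q).

(** Any finite bound will do, as it only serves to make the supremum in [mx_opnorm] genuine: each
    row is bounded by induction on its entries, and the row bounds are added up. *)
Lemma mx_app_bound : exists M : R,
  forall x, dsum_norm (mx_app T x) <= M * dsum_norm x.
Proof.
have row p : exists M : R, forall x, ell2_norm (mx_app T x p) <= M * dsum_norm x.
  rewrite /mx_app; elim: (index_enum _) => [|q r [M IHr]].
    by exists 0 => x; rewrite big_nil ell2_norm0 mul0r.
  have [N N0 TN] := bounded_op_bound (T_bounded p q).
  exists (2 * (N + M)) => x; rewrite big_cons.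
  apply: le_trans (ell2_norm_add _ _) _.
  rewrite -mulrA ler_wpM2l// mulrDl lerD//.
  apply: le_trans (TN _) _; rewrite ler_wpM2l//.
  exact: ell2_norm_le_dsum_norm.
have /choice[M MP] := row; exists (\sum_p M p) => x.
apply: le_trans (dsum_norm_le_sum _) _.
by rewrite mulr_suml; apply: ler_sum => p _.
Qed.

Lemma mx_appZ (a : R[i]) x : mx_app T (a *: x) = a *: mx_app T x.
Proof.
apply/funext => p.
change (\sum_(q < l) T p q (a *: x q) = a *: \sum_(q < l) T p q (x q)).
rewrite scaler_sumr; apply: eq_bigr => q _.
by have [f ->] := bounded_op_linear (T_bounded p q); rewrite -linearZ.
Qed.

Lemma mx_app_comm (W : ell2 -> ell2) : bounded_op W ->
  (forall p q z, T p q (W z) = W (T p q z)) ->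
  forall x p, mx_app T (fun q => W (x q)) p = W (mx_app T x p).
Proof.
move=> bW TW x p; rewrite /mx_app; under eq_bigr do rewrite TW.
by have [f ->] := bounded_op_linear bW; rewrite linear_sum.
Qed.

Lemma le_mx_opnorm V x : (forall a z, V z -> V (a *: z)) -> (forall q, V (x q)) ->
  dsum_norm (mx_app T x) <= mx_opnorm V T * dsum_norm x.
Proof.
move=> VZ Vx; have [M TM] := mx_app_bound.
apply: (@le_sup_homogeneous R _ (@dsum_norm R I l)
  (fun x => dsum_norm (mx_app T x)) [set x | forall q, V (x q)] M) => //.
- exact: dsum_norm_ge0.
- exact: dsum_normZ.
- by move=> a y; rewrite mx_appZ dsum_normZ.
- by move=> a y Vy q; exact: VZ (Vy q).
Qed.

Lemma mx_opnorm_le V (M : R) : V 0 ->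
  (forall x, (forall q, V (x q)) -> dsum_norm x <= 1 -> dsum_norm (mx_app T x) <= M) ->
  mx_opnorm V T <= M.
Proof.
move=> V0 TM; apply: ge_sup; last by move=> _ [x [Vx x1] <-]; exact: TM.
exists (dsum_norm (mx_app T (fun=> 0))), (fun=> 0) => //.
by split; rewrite //= dsum_norm0.
Qed.

Lemma mx_opnorm_ge0 V : V 0 -> 0 <= mx_opnorm V T.
Proof.
move=> V0; have [M TM] := mx_app_bound.
have zero_in : [set dsum_norm (mx_app T x) |
    x in [set x : 'I_l -> ell2 | (forall q, V (x q)) /\ dsum_norm x <= 1]]
    (dsum_norm (mx_app T (fun=> 0))).
  exists (fun=> 0) => //.
  by split; rewrite //= dsum_norm0.
apply: le_trans (dsum_norm_ge0 (mx_app T (fun=> 0))) _.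
apply: ub_le_sup zero_in; exists `|M| => _ [x [_ x1] <-].
apply: le_trans (TM x) _; apply: (@le_trans _ _ (`|M| * dsum_norm x)).
  by rewrite ler_wpM2r ?dsum_norm_ge0// ler_norm.
by rewrite ler_piMr.
Qed.

Lemma mx_opnormS V V' : V 0 -> V `<=` V' -> (forall a z, V' z -> V' (a *: z)) ->
  mx_opnorm V T <= mx_opnorm V' T.
Proof.
move=> V0 VV' V'Z; apply: mx_opnorm_le => // x Vx x1.
apply: le_trans (@le_mx_opnorm V' x V'Z _) _; first by move=> q; exact: VV'.
by rewrite ler_piMr// mx_opnorm_ge0//; exact: VV'.
Qed.

End Bounded.
End MatrixNorm.

(** * The tensor algebra *)

Section TensorAlgebraTheory.
Variables (R : realType) (Omega : finType) (P : Omega -> Omega -> R).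
Hypothesis P_ge0 : forall i j, 0 <= P i j.
Local Notation idx := (Gr_index P).
Local Notation HP := (HP P).
Implicit Types (t u : idx) (k s c : Omega).

Lemma tensor_algebra_bounded f : tensor_algebra P f -> bounded_op f.
Proof.
move=> /(_ _ (conj (@closed_subalgebra_bounded_op R idx) _)); apply.
by move=> g [n [i [j [_ []]]]].
Qed.

(** Minimality of [tensor_algebra] against the commutant of [W] leaves only the generators, and
    [bounded_op_ext] leaves only basis vectors. *)
Lemma tensor_algebra_comm (W f : HP -> HP) : bounded_op W ->
  (forall g, S_ops P g -> forall t,
    g (W (basis_vec R t)) = W (g (basis_vec R t))) ->
  tensor_algebra P f -> forall x, f (W x) = W (f x).
Proof.
move=> bW SW /(_ _ (conj (closed_subalgebra_commutant bW) _)) fP.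
suff [] : bounded_op f /\ (forall x, f (W x) = W (f x)) by [].
apply: fP => g Sg; have bg : bounded_op g by case: Sg => [n [i [j [_ []]]]].
split=> // x; apply: (@bounded_op_ext _ _ (g \o W) (W \o g)) => [||t].
- exact: bounded_op_comp.
- exact: bounded_op_comp.
- exact: SW.
Qed.

Lemma xi_val t m j k : val t = (m, j, k) -> xi P m j k = basis_vec R t.
Proof. by move=> tE; rewrite /xi -tE valK. Qed.

Lemma S_zero n i j f : is_S P n i j f -> f 0 = 0.
Proof. by move=> [/bounded_op_linear[g ->] _]; rewrite linear0. Qed.

(** The orthogonal projection onto [HPk P k]. *)
Definition color k : HP -> HP := restr (fun t => (val t).2 == k).

Lemma bounded_op_color k : bounded_op (color k).
Proof. exact: bounded_op_pull. Qed.

Lemma HPk_color k (x : HP) : HPk P k x <-> color k x = x.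
Proof.
split=> [xk|xE t tk]; last by rewrite -xE /color restrE (negbTE tk).
by apply: ell2P => t; rewrite /color restrE; case: ifPn => // /xk ->.
Qed.

Lemma color_xi k m j c :
  color k (xi P m j c) = if c == k then xi P m j c else 0.
Proof.
rewrite /xi; case: insubP => [t _ tE|_]; last first.
  by rewrite if_same; apply: ell2P => t; rewrite /color restrE if_same.
apply: ell2P => u; rewrite /color restrE.
have -> : c = (val t).2 by rewrite tE.
have [->|ut] := eqVneq u t; first by case: ifP.
by rewrite /= (negbTE ut) if_same; case: ifP => //= _; rewrite (negbTE ut).
Qed.

(** Generators keep the last index of a basis vector. Commuting with these projections is what makes
    every [HPk P k] reducing. *)
Lemma S_color k g t : S_ops P g ->
  g (color k (basis_vec R t)) = color k (g (basis_vec R t)).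
Proof.
move=> [n [i [j [_ gS]]]]; have [bg gE] := gS.
case tE : (val t) => [[m j'] c]; have tpos : 0 < mpow P m j' c.
  by have := valP t; rewrite tE.
have [W WE] := bounded_op_linear (bounded_op_color k).
rewrite -(xi_val tE) color_xi gE//; case jj : (j == j').
  rewrite [in RHS]WE linearZ/= -WE color_xi.
  by case: (c == k); rewrite ?gE ?jj ?(S_zero gS) ?scaler0.
by rewrite WE linear0; case: (c == k); rewrite ?gE ?jj ?(S_zero gS).
Qed.

(** * The intertwining isometry along a sole predecessor *)

Section Shift.
Variables k s : Omega.
Hypothesis ks : sole_predecessor P k s.

(** The backward index map of xi_(m,j,k) |-> xi_(m+1,j,s), as [pull] expects. Level 0 is not in the
    range of the shift and must be excluded, since [.-1] would fix it. *)
Definition unshift (t : idx) : option idx :=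
  if (0 < (val t).1.1)%N && ((val t).2 == s)
  then insub ((val t).1.1.-1, (val t).1.2, k) else None.

Lemma unshiftP t u : unshift t = Some u <->
  (val u).2 = k /\ val t = ((val u).1.1.+1, (val u).1.2, s).
Proof.
rewrite /unshift; split=> [|[uk ->]]; last first.
  by rewrite /= eqxx -uk -!surjective_pairing valK.
case tE : (val t) => [[[|m] j] c]//=; have [->|//] := eqVneq c s.
by case: insubP => // u' _ uE [<-]; rewrite uE.
Qed.

Lemma unshift_inj t t' u :
  unshift t = Some u -> unshift t' = Some u -> t = t'.
Proof.
by move=> /unshiftP[_ tE] /unshiftP[_ tE']; apply: val_inj; rewrite tE.
Qed.

(** By [mpowS_sole] and [P k s > 0], the shifted triple is again an index. Hence [shift] loses no
    coordinate of [HPk P k]. *)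
Lemma unshift_surj u : (val u).2 = k -> exists t, unshift t = Some u.
Proof.
move=> uk; have tpos : 0 < mpow P (val u).1.1.+1 (val u).1.2 s.
  by rewrite (mpowS_sole P_ge0 _ _ ks) mulr_gt0 ?ks.1// -uk (valP u).
exists (Sub ((val u).1.1.+1, (val u).1.2, s) tpos).
by apply/unshiftP; rewrite SubK.
Qed.

Definition shift : HP -> HP := pull unshift_inj.

Lemma bounded_op_shift : bounded_op shift.
Proof. exact: bounded_op_pull. Qed.

Lemma shift_norm x : HPk P k x -> ell2_norm (shift x) = ell2_norm x.
Proof.
move=> xk; apply: pull_norm => u ut; apply: xk; apply/eqP => uk.
by have [t] := unshift_surj uk; exact: ut.
Qed.

Lemma shift_HPk x : HPk P s (shift x).
Proof.
move=> t /negbTE ts; rewrite /shift pullE; case tE : unshift => [u|]//=.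
by move/unshiftP: tE ts => [_ ->] /=; rewrite eqxx.
Qed.

Lemma shift_xi m j c : 0 < mpow P m j c ->
  shift (xi P m j c) = if c == k then xi P m.+1 j s else 0.
Proof.
move=> pos; pose u : idx := exist _ (m, j, c) pos.
rewrite (@xi_val u)//; have [ck|ck] := eqVneq c k; last first.
  by apply: pull_basis_vec0 => t /unshiftP[/= cE]; rewrite cE eqxx in ck.
have [t tu] := @unshift_surj u ck.
by have /unshiftP[_ /xi_val ->] := tu; exact: pull_basis_vec.
Qed.

Lemma S_shift g t : S_ops P g ->
  g (shift (basis_vec R t)) = shift (g (basis_vec R t)).
Proof.
move=> [n [i [j [ij gS]]]]; have [bg gE] := gS.
case tE : (val t) => [[m j'] c]; have pos : 0 < mpow P m j' c.
  by have := valP t; rewrite tE.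
have [W WE] := bounded_op_linear bounded_op_shift.
rewrite -(xi_val tE) shift_xi// gE//.
have [jj|jj] := eqVneq j j'; last first.
  rewrite WE linear0; case: eqP => [ck|_]; last exact: S_zero gS.
  rewrite gE ?(negbTE jj)//.
  by rewrite (mpowS_sole P_ge0 _ _ ks) mulr_gt0 ?ks.1// -ck.
rewrite [in RHS]WE linearZ/= -WE shift_xi; last first.
  by apply: mpowD_gt0 pos => //; rewrite -jj.
case: eqP => [ck|_]; last by rewrite scaler0 (S_zero gS).
rewrite gE; last by rewrite (mpowS_sole P_ge0 _ _ ks) mulr_gt0 ?ks.1// -ck.
(* With [n + m.+1] rewritten as [(n + m).+1], numerator and denominator both acquire the factor
   [P k s], which cancels. *)
rewrite jj eqxx addnS !(mpowS_sole P_ge0 _ _ ks) ck.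
have ks0 : P k s != 0 by rewrite gt_eqF ?ks.1.
by rewrite mulrA -mulf_div mulfV// mulr1.
Qed.

End Shift.

(** * Comparing the norms of the restrictions *)

Section Norms.
Variables (l : nat) (T : 'M[HP -> HP]_l).
Hypothesis T_in : forall p q, tensor_algebra P (T p q).

Let T_bounded p q : bounded_op (T p q).
Proof. exact: tensor_algebra_bounded. Qed.

Lemma HPk0 k : HPk P k 0. Proof. by []. Qed.

Lemma HPkZ k a x : HPk P k x -> HPk P k (a *: x).
Proof. by move=> xk t tk; rewrite ell2_scaleE xk// mulr0. Qed.

Lemma mx_app_color k x p :
  mx_app T (fun q => color k (x q)) p = color k (mx_app T x p).
Proof.
apply: mx_app_comm; first exact: bounded_op_color.
move=> p' q z; apply: tensor_algebra_comm => //; first exact: bounded_op_color.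
by move=> g Sg t; exact: S_color.
Qed.

(** Shifting every entry moves [x] into [HPk P s], commutes with [T], and changes neither the norm
    of [x] nor that of its image. *)
Lemma mx_opnorm_sole_predecessor k s : sole_predecessor P k s ->
  mx_opnorm (HPk P k) T <= mx_opnorm (HPk P s) T.
Proof.
move=> ks; apply: mx_opnorm_le => [|x xk x1]; first exact: HPk0.
have shift_x : dsum_norm (fun q => shift k s (x q)) = dsum_norm x.
  by apply: eq_dsum_norm => q; exact: shift_norm.
(* [shift] is isometric only on [HPk P k], so the image of [x] must be seen to stay there. *)
have Tx_k p : HPk P k (mx_app T x p).
  apply/HPk_color; rewrite -mx_app_color; congr (mx_app T _ p).
  by apply/funext => q; apply/HPk_color.
have <- : dsum_norm (mx_app T (fun q => shift k s (x q))) = dsum_norm (mx_app T x).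
  apply: eq_dsum_norm => p; rewrite -[RHS](shift_norm ks)//; congr ell2_norm.
  apply: mx_app_comm; first exact: bounded_op_shift.
  move=> p' q z; apply: tensor_algebra_comm => //; first exact: bounded_op_shift.
  by move=> g Sg t; exact: S_shift.
apply: le_trans (le_mx_opnorm T_bounded (@HPkZ s) _) _.
  by move=> q; exact: shift_HPk.
by rewrite shift_x ler_piMr// mx_opnorm_ge0.
Qed.

Lemma mx_opnorm_HPk_le k : mx_opnorm (HPk P k) T <= mx_opnorm [set: HP] T.
Proof. exact: mx_opnormS. Qed.

Lemma dsum_norm_color x :
  \sum_k dsum_norm (fun q : 'I_l => color k (x q)) ^+ 2 = dsum_norm x ^+ 2.
Proof.
under eq_bigr do rewrite dsum_norm_sqr.
rewrite exchange_big dsum_norm_sqr /=; apply: eq_bigr => q _.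
exact: restr_norm_sum.
Qed.

(** [T] is block diagonal for the orthogonal decomposition into the [HPk P k], so Pythagoras before
    and after applying [T] reduces the bound to one block at a time. *)
Lemma mx_opnorm_le_HPk M : 0 <= M ->
  (forall k, mx_opnorm (HPk P k) T <= M) -> mx_opnorm [set: HP] T <= M.
Proof.
move=> M0 TM; apply: mx_opnorm_le => // x _ x1.
rewrite -ler_sqr ?nnegrE ?dsum_norm_ge0// -dsum_norm_color.
apply: (@le_trans _ _ (M ^+ 2 * dsum_norm x ^+ 2)); last first.
  by rewrite ler_piMr ?sqr_ge0// expr_le1 ?dsum_norm_ge0.
rewrite -dsum_norm_color mulr_sumr; apply: ler_sum => k _.
rewrite -exprMn lerXn2r ?nnegrE ?mulr_ge0 ?dsum_norm_ge0//.
have -> : dsum_norm (fun q => color k (mx_app T x q)) =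
    dsum_norm (mx_app T (fun q => color k (x q))).
  by apply: eq_dsum_norm => p; rewrite mx_app_color.
apply: le_trans (le_mx_opnorm T_bounded (@HPkZ k) _) _.
  by move=> q t /negbTE tk; rewrite /color restrE tk.
by rewrite ler_wpM2r ?dsum_norm_ge0.
Qed.

End Norms.

End TensorAlgebraTheory.

(** * The norm is attained at an escorted state *)

Theorem corollary4p4 (R : realType) (Omega : finType) (P : Omega -> Omega -> R)
    (P_stochastic : stochastic P) (P_irreducible : irreducible P)
    (P_not_cycle : ~ is_cycle P)
    (l : nat) (l_ge1 : (1 <= l)%N) (T : 'M[HP P -> HP P]_l)
    (T_in : forall p q : 'I_l, tensor_algebra P (T p q)) :
  is_max [set mx_opnorm (HPk P k) T | k in [set k | escorted P k]]
         (mx_opnorm [set: HP P] T).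
Proof.
have P_ge0 i j : 0 <= P i j by have /andP[] := P_stochastic.1 i j.
(* The maximized function sends a state to the norm of the restriction of [T] to its summand; the
   escorted state obtained is maximal among all states, so its summand alone bounds the full
   norm. *)
have [k ke kmax] := escorted_maximizer P_irreducible P_not_cycle
  (mx_opnorm_sole_predecessor P_ge0 T_in).
split; last by move=> _ [j _ <-]; exact: mx_opnorm_HPk_le.
exists k => //; apply/le_anti; rewrite mx_opnorm_HPk_le//=.
apply: mx_opnorm_le_HPk => //; apply: mx_opnorm_ge0; last exact: HPk0.
by move=> p q; exact: tensor_algebra_bounded.
Qed.
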